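(* For every graph $G$ with at least one edge, the line graph $L(G)$ satisfies $\mathrm{fun}(L(G))\le 6$.
   Context: All graphs are finite and simple (undirected, no loops, no multiple edges). For a graph $G=(V,E)$ let $A(x,y)=1$ if $x,y\in V$ are adjacent and $A(x,y)=0$ otherwise. Functionality: a vertex $y\in V$ is a function of vertices $x_1,\dots,x_k\in V\setminus\{y\}$ if there exists a Boolean function $f:\{0,1\}^k\to\{0,1\}$ such that for every $z\in V\setminus\{y,x_1,\dots,x_k\}$, $A(y,z)=f(A(x_1,z),\dots,A(x_k,z))$. The functionality $\mathrm{fun}(y)$ of $y$ (in $G$) is the minimum $k\ge 0$ such that $y$ is a function of some $k$ vertices. The functionality of a graph with nonempty vertex set is $\mathrm{fun}(G)=\max_H\min_{y\in V(H)}\mathrm{fun}(y)$, where the maximum is over all induced subgraphs $H$ of $G$ with nonempty vertex set and $\mathrm{fun}(y)$ is computed in $H$. The line graph $L(G)$ of a graph $G$ is the graph with vertex set $E(G)$ in which two distinct vertices are adjacent if and only if the corresponding edges of $G$ share a vertex. *)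

(* Defs.v *)
From mathcomp Require Import all_boot.

Set Implicit Arguments.
Unset Strict Implicit.
Unset Printing Implicit Defensive.

Record sgraph := SGraph {
  vertex :> finType;
  adj : rel vertex;
  adj_sym : symmetric adj;
  adj_irrefl : irreflexive adj
}.

Section Functionality.

Variable G : sgraph.

(* The x_i are not required to be pairwise distinct; this does not change the
   minimum below, since repeated vertices can be dropped. *)
Definition is_function_of (k : nat) (y : G) (x : k.-tuple G) : bool :=
  [exists f : {ffun k.-tuple bool -> bool}, forall z : G,
    (z != y) && (z \notin x) ==>
      (adj y z == f [tuple adj (tnth x i) z | i < k])].

Definition is_function_of_some (y : G) (k : nat) : bool :=
  [exists x : k.-tuple G, (y \notin x) && is_function_of y x].

(* Every vertex is vacuously a function of all the other vertices. *)
Lemma ex_is_function_of_some (y : G) : exists k, is_function_of_some y k.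
Proof.
exists (size (enum (predC1 y))); apply/existsP.
exists (in_tuple (enum (predC1 y))).
rewrite mem_enum inE eqxx /=; apply/existsP; exists [ffun=> false].
by apply/forallP => z; rewrite mem_enum inE; case: (z == y).
Qed.

Definition vertex_functionality (y : G) : nat :=
  ex_minn (ex_is_function_of_some y).

(* The minimum over all vertices; the value 0 is used only when G has no
   vertex. *)
Definition min_vertex_functionality : nat :=
  if [pick y : G] is Some y0
  then vertex_functionality [arg min_(y < y0) vertex_functionality y]
  else 0.

End Functionality.

Section Induced.

Variables (G : sgraph) (H : {set G}).

Definition induced_adj : rel {x : G | x \in H} :=
  fun u v => adj (val u) (val v).

Lemma induced_adj_sym : symmetric induced_adj.
Proof. by move=> u v; apply: adj_sym. Qed.

Lemma induced_adj_irrefl : irreflexive induced_adj.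
Proof. by move=> u; apply: adj_irrefl. Qed.

Definition induced : sgraph := SGraph induced_adj_sym induced_adj_irrefl.

End Induced.

Definition functionality (G : sgraph) : nat :=
  \max_(H : {set G} | H != set0) min_vertex_functionality (induced H).

Section LineGraph.

Variable G : sgraph.

Definition edges : {set {set G}} :=
  [set e | [exists x, exists y, adj x y && (e == [set x; y])]].

Definition line_adj : rel {e : {set G} | e \in edges} :=
  fun e e' => (e != e') && (val e :&: val e' != set0).

Lemma line_adj_sym : symmetric line_adj.
Proof. by move=> e e'; rewrite /line_adj eq_sym setIC. Qed.

Lemma line_adj_irrefl : irreflexive line_adj.
Proof. by move=> e; rewrite /line_adj eqxx. Qed.

Definition line_graph : sgraph := SGraph line_adj_sym line_adj_irrefl.

End LineGraph.

(* Main.v *)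
(* Every vertex of every induced subgraph of L(G), i.e. every edge e = ab, has
   functionality at most 6.  At each endpoint, say a, list three other edges, or
   all of them if there are fewer.  An edge z outside the list contains a exactly
   when the list has three edges and z meets all of them: an edge that avoids a
   would have to contain three distinct neighbours of a. *)
Require Import Defs.
From mathcomp Require Import all_boot.

(** A witness [f] sends a pattern to true when some vertex outside [y] and [s] shows that pattern
    and is adjacent to [y]; the hypothesis says that the choice of this vertex does not matter. *)
Lemma vertex_functionality_leq (G : sgraph) (y : G) (s : seq G) :
    y \notin s ->
    (forall z z', z != y -> z' != y -> z \notin s -> z' \notin s ->
       {in s, forall x, adj x z = adj x z'} -> adj y z = adj y z') ->
  vertex_functionality y <= size s.
Proof.
move=> ys sP; rewrite /vertex_functionality; case: ex_minnP => m _; apply.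
apply/existsP; exists (in_tuple s); rewrite ys /=.
pose pattern (z : G) := [tuple adj (tnth (in_tuple s) i) z | i < size s].
apply/existsP; exists [ffun t => [exists z,
  [&& z != y, z \notin s, pattern z == t & adj y z]]].
apply/forallP => z; apply/implyP => /andP[zy zs]; rewrite ffunE.
apply/eqP; apply/idP/existsP => [yz|[z' /and4P[z'y z's /eqP eq_pat yz']]].
  by exists z; rewrite zy zs yz eqxx.
rewrite (sP z z') // => x xs; have /tnthP[i ->] : x \in in_tuple s by [].
by move/(congr1 (fun t => tnth t i)): eq_pat; rewrite !tnth_mktuple.
Qed.

(** If [a] is not in [Z], each member of [P] is [[set a; x]] for some [x] in [Z], so [P] has at most
    [#|Z|] members. *)
Lemma mem_of_meets_three (T : finType) (a : T) (Z : {set T})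
    (P : {set {set T}}) :
    #|Z| <= 2 -> 2 < #|P| ->
    {in P, forall B : {set T}, [&& #|B| == 2, a \in B & B :&: Z != set0]} ->
  a \in Z.
Proof.
move=> Z2 P3 Pstar; apply: contraLR P3 => aZ; rewrite -leqNgt.
apply: leq_trans Z2; apply: leq_trans (leq_imset_card (fun x => [set a; x]) Z).
apply/subset_leq_card/subsetP => B /Pstar/and3P[/eqP B2 aB /set0Pn[x]].
rewrite inE => /andP[xB xZ]; apply/imsetP; exists x => //.
apply/esym/eqP; rewrite eqEcard subUset !sub1set aB xB B2 cards2.
by case: eqVneq aZ => // ->; rewrite xZ.
Qed.

Section EdgeIntersection.

Variables (V : sgraph) (T : finType) (ends : V -> {set T}).
Hypothesis ends_inj : injective ends.
Hypothesis card_ends : forall v, #|ends v| = 2.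
Hypothesis adj_ends :
  forall u v, adj u v = (u != v) && (ends u :&: ends v != set0).

Definition star_sample (y : V) (a : T) : seq V :=
  take 3 (enum [set v | (v != y) && (a \in ends v)]).

Lemma mem_star_sample {y a v} :
  v \in star_sample y a -> (v != y) && (a \in ends v).
Proof. by move/mem_take; rewrite mem_enum inE. Qed.

(** The right-hand side depends on [z] only through its adjacencies to the sample, as functionality
    requires. *)
Lemma mem_ends_star_sample {y a z} : z != y -> z \notin star_sample y a ->
  (a \in ends z) =
    (size (star_sample y a) == 3) && all (fun x => adj x z) (star_sample y a).
Proof.
set s := star_sample y a => zy zs; apply/idP/andP => [az|[/eqP s3 /allP s_adj]].
  split; last first.
    apply/allP => x xs; rewrite adj_ends; apply/andP; split.
      by apply: contraNneq zs => <-.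
    by have /andP[_ ax] := mem_star_sample xs; apply/set0Pn; exists a; rewrite inE ax.
  move: zs; rewrite /s /star_sample size_take_min; set S := enum _.
  (* With at most three candidates the sample is all of [S], so it would contain [z]. *)
  case: (leqP (size S) 3) => [S3|//].
  by rewrite take_oversize // mem_enum inE zy az.
apply: (@mem_of_meets_three _ _ _ [set ends x | x in s]).
- by rewrite card_ends.
(* Since [ends] is injective, distinct sampled vertices give distinct pairs. *)
- rewrite card_imset //; have /card_uniqP-> : uniq s by rewrite take_uniq ?enum_uniq.
  by rewrite s3.
move=> _ /imsetP[x xs ->]; rewrite card_ends eqxx.
have /andP[_ ->] := mem_star_sample xs.
by have := s_adj x xs; rewrite adj_ends => /andP[].
Qed.

Lemma vertex_functionality_ends (y : V) : vertex_functionality y <= 6.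
Proof.
have /eqP/cards2P[a [b [_ y_ab]]] := card_ends y.
pose s := star_sample y a ++ star_sample y b.
have s6 : size s <= 6.
  by rewrite size_cat (@leq_add _ _ 3 3) // size_take_min geq_minl.
apply: leq_trans s6; apply: vertex_functionality_leq.
  by rewrite mem_cat; apply/norP; split; apply/negP => /mem_star_sample; rewrite eqxx.
have adj_y z : z != y -> adj y z = (a \in ends z) || (b \in ends z).
  move=> zy; rewrite adj_ends eq_sym zy y_ab.
  apply/set0Pn/orP => [[x]|[az|bz]]; last 2 first.
  - by exists a; rewrite !inE eqxx.
  - by exists b; rewrite !inE eqxx orbT.
  by rewrite !inE => /andP[/orP[]/eqP->]; [left|right].
move=> z z' zy z'y; rewrite !mem_cat !negb_or => /andP[za zb] /andP[z'a z'b] eq_s.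
rewrite !adj_y // (mem_ends_star_sample zy za) (mem_ends_star_sample z'y z'a).
rewrite (mem_ends_star_sample zy zb) (mem_ends_star_sample z'y z'b).
by congr (_ && _ || _ && _); apply: eq_in_all => x xs; apply: eq_s;
  rewrite mem_cat xs ?orbT.
Qed.

End EdgeIntersection.

Lemma card_edge (G : sgraph) (e : {set G}) : e \in edges G -> #|e| = 2.
Proof.
rewrite inE => /existsP[x /existsP[y /andP[xy /eqP->]]]; rewrite cards2.
by case: eqVneq xy => // ->; rewrite adj_irrefl.
Qed.

Theorem theorem6 (G : sgraph) (hG : edges G != set0) :
  functionality (line_graph G) <= 6.
Proof.
apply/bigmax_leqP => H _; rewrite /min_vertex_functionality.
(* The bound holds at every vertex, so the minimiser is replaced by an arbitrary [y]; an empty graph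
   has the default value 0. *)
case: pickP => // y0 _; move: [arg min_(_ < _) _]%N => y.
(* The two [val] forget membership in [H] and then in [edges G]. *)
pose ends (v : induced H) : {set G} := val (val v).
apply: (@vertex_functionality_ends _ G ends).
- by move=> u v /val_inj/val_inj.
- by move=> v; apply: card_edge (valP (val v)).
by move=> u v; rewrite /= /induced_adj /= /line_adj (inj_eq val_inj).
Qed.
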